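(* Assume the Degree Bound: for every $d\ge5$ and all integers $1\le a\le b$ with $a+b=d$, the remainder $R_{(a,b)}$ has total degree at most $d-3$. Then for every $d\ge5$ the homogeneous part of total degree $d-2$ of $E_d(m,n)$ (i.e. of the polynomial $p_d(m,n)$) is $$\frac{4}{(d-2)!}\,\big(m^{d-2}+n^{d-2}\big).$$
   Context: $G_{m,n}$ is the $m\times n$ grid graph with cells $(i,j)$, $1\le i\le m$, $1\le j\le n$, two cells adjacent when they differ by one in a single coordinate. A height function on $G_{m,n}$ is a map $h\colon G_{m,n}\to\mathbb{Z}$ with $|h(u)-h(v)|=1$ on every edge $uv$ and $h(1,1)=0$. A cell is a strict local minimum (maximum) if every neighbour has value larger (smaller) by one; the extrema are the strict local minima and maxima. $E_d(m,n)$ is the number of height functions on $G_{m,n}$ with exactly $d$ extrema. For each $d\ge2$, $p_d(m,n)$ denotes the (unique) bivariate polynomial that agrees with $E_d(m,n)$ for all $m,n\ge\max(d-1,2)$; such a polynomial exists, and parts and degrees of $E_d$ refer to $p_d$. The sides of $G_{m,n}$ are the top row $i=1$, bottom row $i=m$, left column $j=1$ and right column $j=n$. For $a,b\ge1$ and $m,n\ge2$, the remainder $R_{(a,b)}(m,n)$ is the number of height functions on $G_{m,n}$ with exactly $a$ strict local minima and exactly $b$ strict local maxima whose strict local minima do not all lie on a single side. With $d=a+b\ge3$ and $a\le b$, $R_{(a,b)}$ agrees with a bivariate polynomial on $\{m,n\ge 2d-1\}$, and its total degree means the total degree of that polynomial. *)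

(* Defs.v *)
From HB Require Import structures.
From mathcomp Require Import all_boot all_order all_algebra.
From mathcomp Require Import zify.
From mathcomp Require Export mpoly.

Set Implicit Arguments.
Unset Strict Implicit.
Unset Printing Implicit Defensive.

Import GRing.Theory Num.Theory.

Local Open Scope ring_scope.

(* Cells are indexed from 0: the pair (i, j) stands for the cell
   (i + 1, j + 1) of the m x n grid. *)
Notation cell m n := ('I_m * 'I_n)%type.

Definition adj m n (u v : cell m n) : bool :=
  let next (x y : nat) := (x.+1 == y) || (y.+1 == x) in
  ((u.1 == v.1) && next u.2 v.2) || ((u.2 == v.2) && next u.1 v.1).

Definition is_height m n (h : {ffun cell m n -> int}) : bool :=
  [forall u, forall v, adj u v ==> (`|h u - h v| == 1)] &&
  [forall u : cell m n,
     (u.1 == 0%N :> nat) && (u.2 == 0%N :> nat) ==> (h u == 0)].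

Record height m n := Height {
  hfun :> {ffun cell m n -> int};
  _ : is_height hfun
}.

HB.instance Definition _ m n := [isSub for @hfun m n].
HB.instance Definition _ m n := [Countable of height m n by <:].

(* Since |h(i, j)| <= i + j, there are only finitely many integer-valued
   height functions, so that counting them by #|_| is meaningful. *)
Lemma height_bound m n (h : height m n) (u : cell m n) :
  `|h u| <= (u.1 + u.2)%:Z.
Proof.
case: h => h /= /andP[/'forall_forallP hE /forallP h0].
have [k] := ubnP (u.1 + u.2)%N; elim: k u => // k IHk [[[|i] lti] [j ltj]] /=.
  case: j ltj => [|j] ltj; rewrite ltnS => lejk.
    by have /eqP-> := h0 (Ordinal lti, Ordinal ltj).
  have ltj' : (j < n)%N by exact: ltnW.
  have /= := IHk (Ordinal lti, Ordinal ltj') lejk.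
  have := hE (Ordinal lti, Ordinal ltj) (Ordinal lti, Ordinal ltj').
  by rewrite /adj /= !eqxx orbT /= => /eqP; lia.
rewrite ltnS => lejk.
have lti' : (i < m)%N by exact: ltnW.
have /= := IHk (Ordinal lti', Ordinal ltj) lejk.
have := hE (Ordinal lti, Ordinal ltj) (Ordinal lti', Ordinal ltj).
by rewrite /adj /= !eqxx !orbT /= => /eqP; lia.
Qed.

Definition height_code m n (h : height m n) :
    {ffun cell m n -> 'I_((m + n).*2.+1)} :=
  [ffun u => inord (absz (h u + (m + n)%:Z))].

Definition height_decode m n
    (c : {ffun cell m n -> 'I_((m + n).*2.+1)}) : option (height m n) :=
  insub [ffun u => (c u : nat)%:Z - (m + n)%:Z].

Lemma height_codeK m n : pcancel (@height_code m n) (@height_decode m n).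
Proof.
move=> h; rewrite /height_decode.
suff -> : [ffun u => (height_code h u : nat)%:Z - (m + n)%:Z] = h :> {ffun _}.
  by rewrite valK.
apply/ffunP => u; rewrite !ffunE.
have := height_bound h u; have := ltn_ord u.1; have := ltn_ord u.2.
move: (h u) (nat_of_ord u.1) (nat_of_ord u.2) => x i j ltj lti.
by rewrite ler_norml => /andP[lex gex]; rewrite inordK; lia.
Qed.

HB.instance Definition _ m n : isFinite (height m n) :=
  PCanIsFinite (@height_codeK m n).

Definition minima m n (h : height m n) : {set cell m n} :=
  [set u | [forall v, adj u v ==> (h v == h u + 1)]].

Definition maxima m n (h : height m n) : {set cell m n} :=
  [set u | [forall v, adj u v ==> (h v == h u - 1)]].

Definition extrema m n (h : height m n) : {set cell m n} :=
  minima h :|: maxima h.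

Definition count_extrema (d m n : nat) : nat :=
  #|[set h : height m n | #|extrema h| == d]|.

Definition on_one_side m n (S : {set cell m n}) : bool :=
  [|| S \subset [set u : cell m n | u.1 == 0%N :> nat],
      S \subset [set u : cell m n | u.1.+1 == m],
      S \subset [set u : cell m n | u.2 == 0%N :> nat]
    | S \subset [set u : cell m n | u.2.+1 == n]].

Definition remainder (a b m n : nat) : nat :=
  #|[set h : height m n | [&& #|minima h| == a, #|maxima h| == b
                            & ~~ on_one_side (minima h)]]|.

(* In {mpoly rat[2]}, 'X_ord0 plays the role of m and 'X_ord_max that of n. *)
Definition point (m n : nat) (i : 'I_2) : rat :=
  if i == ord0 then m%:R else n%:R.

Definition agrees_from (N : nat) (p : {mpoly rat[2]})
    (f : nat -> nat -> nat) : Prop :=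
  forall m n : nat, (N <= m)%N -> (N <= n)%N -> p.@[point m n] = (f m n)%:R.

(* msize p is one more than the total degree of a nonzero p, and msize 0 = 0. *)
Definition total_degree_le (k : nat) (p : {mpoly rat[2]}) : Prop :=
  (msize p <= k.+1)%N.

Definition degree_bound : Prop :=
  forall d a b : nat,
    (5 <= d)%N -> (1 <= a)%N -> (a <= b)%N -> (a + b = d)%N ->
  exists q : {mpoly rat[2]},
    agrees_from (2 * d - 1) q (remainder a b) /\ total_degree_le (d - 3) q.

(* Main.v *)
Require Import Defs.
From mathcomp Require Import all_boot all_order all_algebra.
From mathcomp Require Import zify ring.

Set Implicit Arguments.
Unset Strict Implicit.
Unset Printing Implicit Defensive.

Import Order.TTheory GRing.Theory Num.Theory.
Local Open Scope ring_scope.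

(** Why the theorem is true.

    Negating a height function exchanges its minima and its maxima, so the
    number N(a, b) of height functions with a minima and b maxima is symmetric,
    and E_d is the sum over 0 < a < d of N(a', b') where (a', b') is the pair
    (a, d - a) rearranged so that a' <= b' (count_extrema_sorted). In each of
    these terms the functions whose minima do not all lie on one side are
    counted by the remainder, which by hypothesis has degree at most d - 3. The
    leading part of E_d is therefore that of the number of one-sided functions,
    and this number can be computed exactly.

    The crucial point (height_slope) is that a height function all of whose
    minima lie on a side increases by one at every step away from that side. If
    some step away from the side went down, one could pick such a step ending
    at the lowest possible cell v; v is off the side, hence not a minimum, and
    has a lower neighbour w. Wherever w is, it is reached by a descending step
    away from the side that ends lower than v, which is absurd. A one-sided
    function is thus determined by its values along the side: it is a path
    (a height function on a grid with a single row) carried across the grid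
    with slope one, its minima being those of the path and its maxima those of
    the path copied onto the opposite side. Conversely every path lifts, so
    each of the four sides contributes as many functions as there are paths
    with a minima and b maxima. As soon as b >= 2 the four classes are disjoint,
    since a function one-sided for two adjacent sides has its only maximum in
    a corner. Summing over a and reading the symmetrisation backwards for paths
    gives the exact identity (count_extrema_sides)

      E_d(m, n) = (sum of remainders) + 2 E_d(1, m) + 2 E_d(1, n).

    A path with n + 2 cells is determined by its first step and by the set of
    the n inner cells where it turns; its extrema are its turns and its two
    ends. Hence E_d(1, n) = 2 C(n - 2, d - 2) (count_extrema_line), and the two
    path terms are the polynomials 4 C(m - 2, d - 2) and 4 C(n - 2, d - 2),
    whose parts of degree d - 2 are 4 m^(d-2) / (d-2)! and 4 n^(d-2) / (d-2)!.
    The polynomial p agrees with the resulting polynomial at all large integer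
    points, hence equals it (mpoly_eventually0). *)

(** * Adjacency and local extrema *)

Lemma adj_row m n (u v : cell m n) :
  u.1 = v.1 -> adj u v = (u.2.+1 == v.2 :> nat) || (v.2.+1 == u.2 :> nat).
Proof.
case: u v => [i j] [_ k] /= <-; rewrite /adj /= eqxx /=.
by rewrite (gtn_eqF (ltnSn _)) andbF orbF.
Qed.

Lemma adj_col m n (u v : cell m n) :
  u.2 = v.2 -> adj u v = (u.1.+1 == v.1 :> nat) || (v.1.+1 == u.1 :> nat).
Proof.
case: u v => [i j] [k _] /= <-; rewrite /adj /= eqxx /=.
by rewrite (gtn_eqF (ltnSn _)) andbF.
Qed.

Lemma adj_split m n (u v : cell m n) :
  adj u v -> u.1 = v.1 \/ u.2 = v.2.
Proof. by case/orP => /andP[/eqP-> _]; [left | right]. Qed.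

Lemma height_adj m n (h : height m n) u v :
  adj u v -> h v = h u + 1 \/ h v = h u - 1.
Proof.
case: h => h /= /andP[/'forall_forallP hE _].
by move=> uv; have := hE u v; rewrite uv => /eqP; lia.
Qed.

Lemma height_origin m n (h : height m n) (u : cell m n) :
  u.1 = 0%N :> nat -> u.2 = 0%N :> nat -> h u = 0.
Proof.
case: h => h /= /andP[_ /forallP h0] u1 u2.
by have := h0 u; rewrite u1 u2 /= => /eqP.
Qed.

Lemma is_heightP m n (h : {ffun cell m n -> int}) :
    (forall u v, adj u v -> h v = h u + 1 \/ h v = h u - 1) ->
    (forall u : cell m n, u.1 = 0%N :> nat -> u.2 = 0%N :> nat -> h u = 0) ->
  is_height h.
Proof.
move=> hE h0; apply/andP; split.
  by apply/'forall_forallP => u v; apply/implyP => /hE; lia.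
by apply/forallP => u; apply/implyP => /andP[/eqP u1 /eqP u2]; apply/eqP/h0.
Qed.

Lemma height_eqP m n (h h' : height m n) : h =1 h' -> h = h'.
Proof. by move=> E; apply/val_inj/ffunP. Qed.

Lemma minimaP m n (h : height m n) u :
  reflect (forall v, adj u v -> h v = h u + 1) (u \in minima h).
Proof.
rewrite inE; apply: (iffP forallP) => H v; first by move/(implyP (H v))/eqP.
by apply/implyP => /H ->.
Qed.

Lemma minima_adj m n (h : height m n) u v :
  u \in minima h -> adj u v -> h v = h u + 1.
Proof. by move/minimaP; apply. Qed.

Lemma notin_minima m n (h : height m n) u :
  u \notin minima h -> exists2 v, adj u v & h v = h u - 1.
Proof.
rewrite inE => /forallPn[v]; rewrite negb_imply => /andP[uv hv]; exists v => //.
by case: (height_adj h uv) => // E; rewrite E eqxx in hv.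
Qed.

Fact opp_height_proof m n (h : height m n) : is_height [ffun u => - h u].
Proof.
apply: is_heightP => [u v uv|u u1 u2]; rewrite !ffunE.
  by have := height_adj h uv; lia.
by rewrite (height_origin h u1 u2).
Qed.
Definition opp_height m n (h : height m n) := Height (opp_height_proof h).

Lemma opp_heightE m n (h : height m n) u : opp_height h u = - h u.
Proof. exact: ffunE. Qed.

Lemma opp_heightK m n : involutive (@opp_height m n).
Proof. by move=> h; apply: height_eqP => u; rewrite !opp_heightE opprK. Qed.

Lemma minima_opp m n (h : height m n) : minima (opp_height h) = maxima h.
Proof.
apply/setP => u; rewrite !inE; apply: eq_forallb => v.
by rewrite !opp_heightE; congr (_ ==> _); lia.
Qed.

Lemma maxima_opp m n (h : height m n) : maxima (opp_height h) = minima h.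
Proof. by rewrite -minima_opp opp_heightK. Qed.

(** * Height functions whose minima lie on one side *)

(** The top row for e = false and the bottom row for e = true, so that both
    horizontal sides are treated at once. *)
Definition row_side m n (e : bool) : {set cell m n} :=
  [set u : cell m n | if e then u.1.+1 == m else u.1 == 0%N :> nat].

Definition row_dist m n (e : bool) (u : cell m n) : nat :=
  if e then (m - u.1.+1)%N else u.1.

Lemma in_row_side m n e (u : cell m n) :
  (u \in row_side m n e) = (row_dist e u == 0%N).
Proof. by rewrite inE /row_dist; case: e; have := ltn_ord u.1; lia. Qed.

Lemma row_dist_adj m n e (u v : cell m n) :
  u.2 = v.2 ->
  adj u v = (row_dist e v == (row_dist e u).+1)
             || (row_dist e u == (row_dist e v).+1).
Proof.
move=> /adj_col->; rewrite /row_dist; case: e; last by lia.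
by have := ltn_ord u.1; have := ltn_ord v.1; lia.
Qed.

(** The key fact: minima confined to a side force a constant slope. Among the
    steps away from the side that descend, take one, from u to v, with h v
    least. Since v is not a minimum it has a lower neighbour w, which is not u. If w lies
    further from the side than v, the step from v to w is lower still; if w
    lies in the row of v, then the cell w' of the column of w in the row of u is
    adjacent both to u and to w, whose values differ by two, so the step from w' to w
    descends and is lower still. *)
Lemma height_slope m n e (h : height m n) :
    minima h \subset row_side m n e ->
  forall u v : cell m n, u.2 = v.2 -> row_dist e v = (row_dist e u).+1 ->
  h v = h u + 1.
Proof.
move=> /subsetP minh.
pose bad (x : cell m n * cell m n) :=
  [&& x.1.2 == x.2.2, row_dist e x.2 == (row_dist e x.1).+1 &
      h x.2 == h x.1 - 1].
suff nobad x : ~~ bad x.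
  move=> u v uv duv; have auv : adj u v by rewrite (row_dist_adj e uv) duv eqxx.
  case: (height_adj h auv) => // hv.
  by have := nobad (u, v); rewrite /bad /= uv duv hv !eqxx.
apply/negP => badx; case: (arg_minP (fun x => h x.2) badx) => -[u v] {x badx}.
move=> /and3P[/= /eqP uv2 /eqP duv /eqP huv] least.
have [w vw hw] : exists2 w, adj v w & h w = h v - 1.
  by apply/notin_minima/negP => /minh; rewrite in_row_side duv.
have [vw1|vw2] := adj_split vw.
  pose w' : cell m n := (u.1, w.2).
  have uw' : adj u w' by rewrite adj_row //= uv2 -adj_row.
  have w'w : adj w' w.
    rewrite (row_dist_adj e) //.
    by move: duv; rewrite /row_dist /= vw1 => ->; rewrite eqxx.
  have hw' : h w' = h w + 1.
    by have := height_adj h uw'; have := height_adj h w'w; lia.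
  have : bad (w', w).
    rewrite /bad /= hw' addrK !eqxx /=.
    by move: duv; rewrite /row_dist /= vw1 => ->; rewrite eqxx.
  by move/least => /=; lia.
move: vw; rewrite (row_dist_adj e) // => /orP[/eqP dw|/eqP dw].
  have /least /= : bad (v, w) by rewrite /bad /= vw2 dw hw !eqxx.
  by lia.
have wu : w = u.
  case: w u vw2 dw uv2 duv {hw huv least} => [i j] [i' j'] /=.
  move=> <- dw -> dv; congr pair; apply: val_inj.
  move: dw dv; rewrite /row_dist /=.
  by case: e {minh bad}; have := ltn_ord i; have := ltn_ord i'; lia.
by rewrite wu in hw; lia.
Qed.

Definition row_sign (e : bool) (k : nat) : int := if e then - k%:Z else k%:Z.

Fact lift_height_proof m n e (f : height 1 n) :
  is_height [ffun u : cell m n => f (ord0, u.2) + row_sign e u.1].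
Proof.
apply: is_heightP => [u v uv|u u1 u2]; rewrite !ffunE; last first.
  by rewrite (height_origin f) // u1; case: e.
have [uv1|uv2] := adj_split uv.
  have fuv : adj (ord0 : 'I_1, u.2) (ord0, v.2) by rewrite adj_row //= -adj_row.
  by have := height_adj f fuv; rewrite uv1; lia.
by move: uv; rewrite adj_col // uv2 /row_sign; case: e; lia.
Qed.
Definition lift_height m n e (f : height 1 n) : height m n :=
  Height (lift_height_proof m e f).

Lemma lift_heightE m n e (f : height 1 n) (u : cell m n) :
  lift_height m e f u = f (ord0, u.2) + row_sign e u.1.
Proof. exact: ffunE. Qed.

Lemma lift_height_inj m n e : injective (@lift_height m.+1 n e).
Proof.
move=> f g fg; apply: height_eqP => -[i j]; rewrite (ord1 i).
move/(congr1 (fun h : height _ _ => h (ord0, j))): fg.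
by rewrite !lift_heightE => /addIr.
Qed.

Lemma opp_lift_height m n e (f : height 1 n) :
  opp_height (lift_height m e f) = lift_height m (~~ e) (opp_height f).
Proof.
apply: height_eqP => u; rewrite !(opp_heightE, lift_heightE) /row_sign.
by case: e => /=; lia.
Qed.

Definition side_row m (e : bool) : 'I_m.+1 := if e then ord_max else ord0.

Lemma side_rowP m n e (u : cell m.+1 n) :
  (u \in row_side m.+1 n e) = (u.1 == side_row m e).
Proof. by rewrite inE /side_row; case: e; rewrite -val_eqE. Qed.

Definition to_side m n e (u : cell 1 n) : cell m.+1 n := (side_row m e, u.2).

Lemma to_side_inj m n e : injective (@to_side m n e).
Proof. by move=> [i j] [i' j'] [->]; rewrite (ord1 i) (ord1 i'). Qed.

Lemma step_toward m n e (u : cell m n) :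
  u \notin row_side m n e ->
  exists2 v : cell m n, u.2 = v.2 & row_dist e u = (row_dist e v).+1.
Proof.
case: u => [i j]; rewrite in_row_side /row_dist /=; have := ltn_ord i.
case: e => /= lti di.
  have lti' : (i.+1 < m)%N by lia.
  by exists (Ordinal lti', j) => //=; lia.
have lti' : (i.-1 < m)%N by lia.
by exists (Ordinal lti', j) => //=; lia.
Qed.

Lemma row_dist_negb m n e (u v : cell m n) :
  row_dist e u = (row_dist e v).+1 -> row_dist (~~ e) v = (row_dist (~~ e) u).+1.
Proof.
by have := ltn_ord u.1; have := ltn_ord v.1; rewrite /row_dist; case: e => /=; lia.
Qed.

Lemma lift_height_slope m n e (f : height 1 n) (u v : cell m n) :
  u.2 = v.2 -> row_dist e u = (row_dist e v).+1 ->
  lift_height m e f u = lift_height m e f v + 1.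
Proof.
move=> uv; rewrite !lift_heightE uv /row_dist /row_sign.
by have := ltn_ord u.1; have := ltn_ord v.1; case: e; lia.
Qed.

(** Off the side a lifted path has a lower neighbour, and along the side it
    reproduces the path while rising towards the interior. *)
Lemma minima_lift m n e (f : height 1 n) :
  minima (lift_height m.+2 e f) = @to_side m.+1 n e @: minima f.
Proof.
apply/setP => u; apply/idP/imsetP => [minu|[w minw ->]].
  have sideu : u.1 = side_row _ e.
    apply/eqP; rewrite -side_rowP; apply: contraT => /step_toward[v uv duv].
    have auv : adj u v by rewrite (row_dist_adj e uv) duv eqxx orbT.
    have := minima_adj minu auv.
    by rewrite (lift_height_slope _ uv duv); lia.
  exists (ord0, u.2); last by rewrite [LHS]surjective_pairing sideu.
  apply/minimaP => -[i j] fuv; have i0 : i = ord0 by exact: ord1.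
  have auv : adj u (u.1, j) by move: fuv; rewrite i0 !adj_row.
  by have := minima_adj minu auv; rewrite !lift_heightE /= i0; lia.
apply/minimaP => v wv; have [wv1|wv2] := adj_split wv.
  have fwv : adj w (ord0, v.2) by rewrite adj_row ?ord1 //= -(adj_row wv1).
  have := minima_adj minw fwv; rewrite !lift_heightE -wv1 /= => ->.
  have -> : (ord0, w.2) = w by case: (w) => i j; rewrite (ord1 i).
  by rewrite addrAC.
have dw : row_dist e (@to_side m.+1 n e w) = 0%N.
  by apply/eqP; rewrite -in_row_side side_rowP.
apply: (@lift_height_slope _ _ e) => //.
by move: wv; rewrite (row_dist_adj e) // dw => /orP[/eqP//|].
Qed.

(** Negation turns a lift from one side into a lift from the opposite side. *)
Lemma maxima_lift m n e (f : height 1 n) :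
  maxima (lift_height m.+2 e f) = @to_side m.+1 n (~~ e) @: maxima f.
Proof. by rewrite -!minima_opp opp_lift_height minima_lift. Qed.

Fact top_row_proof m n (h : height m.+1 n) :
  is_height [ffun u : cell 1 n => h (ord0, u.2)].
Proof.
apply: is_heightP => [[i j] [i' j']|u u1 u2]; rewrite !ffunE; last exact: height_origin.
rewrite [i]ord1 [i']ord1 => uv /=; apply: height_adj.
by move: uv; rewrite !adj_row.
Qed.
Definition top_row m n (h : height m.+1 n) : height 1 n := Height (top_row_proof h).

(** With the slope known, the top row determines everything, even when the
    minima lie on the bottom row. *)
Lemma lift_top_row m n e (h : height m.+1 n) :
  minima h \subset row_side m.+1 n e -> h = lift_height m.+1 e (top_row h).
Proof.
move=> /height_slope slope; apply: height_eqP => -[[i lti] j].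
rewrite lift_heightE ffunE /=.
elim: i lti => [|i IHi] lti.
  have -> : Ordinal lti = ord0 by exact: val_inj.
  by case: e {slope}; rewrite /row_sign ?oppr0 addr0.
have lti' : (i < m.+1)%N by lia.
have := IHi lti'; have := slope (Ordinal lti', j) (Ordinal lti, j) erefl.
have := slope (Ordinal lti, j) (Ordinal lti', j) erefl.
by rewrite /row_dist /row_sign /=; case: e {slope IHi}; lia.
Qed.

Definition heights_with m n (a b : nat) : {set height m n} :=
  [set h : height m n | (#|minima h| == a) && (#|maxima h| == b)].

(** The lift is a bijection from paths to one-sided functions that keeps both
    numbers of extrema. *)
Lemma card_row_sided m n e a b : 
  #|[set h in heights_with m.+2 n a b | minima h \subset row_side m.+2 n e]|
    = #|heights_with 1 n a b|.
Proof.
rewrite -(card_imset _ (@lift_height_inj m.+1 n e)); apply: eq_card => h.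
rewrite !inE; apply/andP/imsetP => [[hab hside]|[f fab ->]].
  exists (top_row h); last exact: lift_top_row.
  move: hab; rewrite [in X in X -> _](lift_top_row hside) minima_lift maxima_lift.
  by rewrite !card_imset ?inE //; exact: to_side_inj.
move: fab; rewrite inE minima_lift maxima_lift.
rewrite !card_imset; try exact: to_side_inj.
move=> ->; split=> //; apply/subsetP => u /imsetP[w _ ->].
by rewrite side_rowP.
Qed.

Lemma maxima_opposite m n e (h : height m n) :
  minima h \subset row_side m n e -> maxima h \subset row_side m n (~~ e).
Proof.
move=> /height_slope slope; apply/subsetP => u; rewrite -minima_opp => maxu.
apply: contraT => /step_toward[v uv duv].
have auv : adj u v by rewrite (row_dist_adj (~~ e) uv) duv eqxx orbT.
have := minima_adj maxu auv; rewrite !opp_heightE (slope u v) //; first by lia.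
by have := row_dist_negb duv; rewrite negbK.
Qed.

(** * Transposition and the four sides *)

Definition col_side m n (e : bool) : {set cell m n} :=
  [set u : cell m n | if e then u.2.+1 == n else u.2 == 0%N :> nat].

Definition swap m n (u : cell m n) : cell n m := (u.2, u.1).

Lemma swapK m n : cancel (@swap m n) (@swap n m).
Proof. by case. Qed.

Lemma adj_swap m n (u v : cell m n) : adj (swap u) (swap v) = adj u v.
Proof. by rewrite /adj orbC. Qed.

Fact tr_height_proof m n (h : height m n) : is_height [ffun u => h (swap u)].
Proof.
apply: is_heightP => [u v uv|u u1 u2]; rewrite !ffunE; last exact: height_origin.
by apply: height_adj; rewrite adj_swap.
Qed.
Definition tr_height m n (h : height m n) : height n m := Height (tr_height_proof h).

Lemma tr_heightE m n (h : height m n) u : tr_height h u = h (swap u).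
Proof. exact: ffunE. Qed.

Lemma tr_heightK m n : cancel (@tr_height m n) (@tr_height n m).
Proof. by move=> h; apply: height_eqP => -[i j]; rewrite !tr_heightE. Qed.

Lemma minima_tr m n (h : height m n) u :
  (u \in minima (tr_height h)) = (swap u \in minima h).
Proof.
apply/minimaP/minimaP => H v uv; last by rewrite !tr_heightE H // adj_swap.
by have := H (swap v); rewrite !tr_heightE swapK => -> //; rewrite -adj_swap swapK.
Qed.

Lemma tr_opp_height m n (h : height m n) :
  tr_height (opp_height h) = opp_height (tr_height h).
Proof. by apply: height_eqP => u; rewrite !(tr_heightE, opp_heightE). Qed.

Lemma maxima_tr m n (h : height m n) u :
  (u \in maxima (tr_height h)) = (swap u \in maxima h).
Proof. by rewrite -!minima_opp -tr_opp_height minima_tr. Qed.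

Lemma card_swap m n (A : {set cell m n}) (B : {set cell n m}) :
  (forall u, (u \in A) = (swap u \in B)) -> #|A| = #|B|.
Proof.
move=> AB; rewrite -(card_imset _ (can_inj (@swapK m n))).
apply: eq_card => u; apply/imsetP/idP => [[v Av ->]|Bu]; first by rewrite -AB.
by exists (swap u); rewrite ?AB ?swapK.
Qed.

Lemma heights_with_tr m n a b (h : height m n) :
  (tr_height h \in heights_with n m a b) = (h \in heights_with m n a b).
Proof.
rewrite !inE (card_swap (minima_tr h)).
by rewrite (card_swap (maxima_tr h)).
Qed.

Lemma minima_tr_sided m n e (h : height m n) :
  (minima (tr_height h) \subset row_side n m e) = (minima h \subset col_side m n e).
Proof.
apply/subsetP/subsetP => H u.
  by rewrite -[u]swapK -minima_tr => /H; rewrite !inE.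
by rewrite minima_tr => /H; rewrite !inE.
Qed.

Lemma card_col_sided m n e a b :
  #|[set h in heights_with m n.+2 a b | minima h \subset col_side m n.+2 e]|
    = #|heights_with 1 m a b|.
Proof.
rewrite -(card_row_sided n m e) -(card_imset _ (can_inj (@tr_heightK n.+2 m))).
apply: eq_card => h; rewrite -[h]tr_heightK (mem_imset _ _ (can_inj (@tr_heightK _ _))).
by rewrite ![_ \in [set h in _ | _]]inE heights_with_tr -minima_tr_sided tr_heightK.
Qed.

Lemma heights_with_opp m n a b (h : height m n) :
  (opp_height h \in heights_with m n a b) = (h \in heights_with m n b a).
Proof. by rewrite !inE minima_opp maxima_opp andbC. Qed.

Lemma card_heights_withC m n a b :
  #|heights_with m n a b| = #|heights_with m n b a|.
Proof.
rewrite -(card_imset _ (inv_inj (@opp_heightK m n))); apply: eq_card => h.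
rewrite -[h]opp_heightK (mem_imset _ _ (inv_inj (@opp_heightK m n))).
by rewrite heights_with_opp opp_heightK.
Qed.

Lemma maxima_opposite_col m n e (h : height m n) :
  minima h \subset col_side m n e -> maxima h \subset col_side m n (~~ e).
Proof.
rewrite -minima_tr_sided => /maxima_opposite /subsetP H; apply/subsetP => u.
by rewrite -[u]swapK -maxima_tr => /H; rewrite !inE.
Qed.

(** Two adjacent sides meet in a single cell. *)
Lemma card_corner m n e e' (A : {set cell m n}) :
  A \subset row_side m n e -> A \subset col_side m n e' -> (#|A| <= 1)%N.
Proof.
move=> /subsetP rowA /subsetP colA; apply/card_le1_eqP => -[i j] [i' j'] Au Av.
move: (rowA _ Au) (rowA _ Av) (colA _ Au) (colA _ Av); rewrite !inE /=.
by case: e e' {rowA colA} => [] [] *; congr pair; apply: val_inj => /=; lia.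
Qed.

Lemma card_opposite_sides m n (A : {set cell m.+2 n}) :
  A \subset row_side m.+2 n false -> A \subset row_side m.+2 n true -> #|A| = 0%N.
Proof.
move=> /subsetP topA /subsetP botA; apply: eq_card0 => u; apply/negP => Au.
by move: (topA _ Au) (botA _ Au); rewrite !inE => /eqP->.
Qed.

Lemma card_opposite_cols m n (A : {set cell m n.+2}) :
  A \subset col_side m n.+2 false -> A \subset col_side m n.+2 true -> #|A| = 0%N.
Proof.
move=> /subsetP topA /subsetP botA; apply: eq_card0 => u; apply/negP => Au.
by move: (topA _ Au) (botA _ Au); rewrite !inE => /eqP->.
Qed.

Lemma card_sep_sum (T : finType) (A : {set T}) (P : pred T) :
  #|[set x in A | P x]| = (\sum_(x in A) P x)%N.
Proof.
by rewrite -sum1dep_card big_mkcondr.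
Qed.

(** The hypothesis 1 < b makes the four one-sided classes disjoint: minima on
    two adjacent sides would force the maxima on the two opposite ones
    (maxima_opposite), hence into a single corner; two opposite sides are
    disjoint and there is at least one minimum. *)
Lemma card_heights_with_sides m n a b : (0 < a)%N -> (1 < b)%N ->
  #|heights_with m.+2 n.+2 a b| =
    (remainder a b m.+2 n.+2 + #|heights_with 1 n.+2 a b|.*2
       + #|heights_with 1 m.+2 a b|.*2)%N.
Proof.
move=> a_gt0 b_gt1; set H := heights_with _ _ _ _.
have -> : remainder a b m.+2 n.+2 =
    #|[set h in H | ~~ on_one_side (minima h)]|.
  by apply: eq_card => h; rewrite !inE andbA.
rewrite -!addnn.
rewrite -{1}(card_row_sided m n.+2 false) -{1}(card_row_sided m n.+2 true).
rewrite -{1}(card_col_sided m.+2 n false) -{1}(card_col_sided m.+2 n true).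
rewrite !card_sep_sum -!big_split /= -sum1_card; apply: eq_bigr => h.
rewrite inE => /andP[/eqP mina /eqP maxb].
rewrite /on_one_side.
have rc e e' : ~ (minima h \subset row_side m.+2 n.+2 e /\
                  minima h \subset col_side m.+2 n.+2 e').
  move=> [/maxima_opposite hr /maxima_opposite_col hc].
  by have := card_corner hr hc; lia.
have rr := @card_opposite_sides m n.+2 (minima h).
have cc := @card_opposite_cols m.+2 n (minima h).
(* It remains to see that of the five indicators exactly one is 1. *)
move: (rc true true) (rc true false) (rc false true) (rc false false) rr cc.
rewrite mina -/(row_side m.+2 n.+2 false) -/(row_side m.+2 n.+2 true).
rewrite -/(col_side m.+2 n.+2 false) -/(col_side m.+2 n.+2 true).
by do 4 case: (minima h \subset _) => //=; lia.
Qed.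

(** * Sorting height functions by their numbers of minima and maxima *)

Lemma exists_minimum m n (h : height m n) (u0 : cell m n) : exists u, u \in minima h.
Proof.
case: (arg_minP h (isT : xpredT u0)) => u _ least; exists u.
apply/minimaP => v uv; have := least v isT.
by case: (height_adj h uv); lia.
Qed.

Lemma exists_maximum m n (h : height m n) (u0 : cell m n) : exists u, u \in maxima h.
Proof. by rewrite -minima_opp; exact: exists_minimum. Qed.

Lemma minima_maxima_disjoint m n (h : height m n.+2) :
  minima h :&: maxima h = set0.
Proof.
apply/setP => u; rewrite in_set0 inE -minima_opp; apply/negP => /andP[minu maxu].
have [v uv] : exists v, adj u v.
  case: u {minu maxu} => i [[|k] ltk].
    by exists (i, Ordinal (isT : (1 < n.+2)%N)); rewrite adj_row.
  by exists (i, Ordinal (ltnW ltk)); rewrite adj_row //= eqxx orbT.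
have := minima_adj minu uv; have := minima_adj maxu uv.
by rewrite !opp_heightE; lia.
Qed.

Lemma card_extrema m n (h : height m n.+2) :
  #|extrema h| = (#|minima h| + #|maxima h|)%N.
Proof. by rewrite /extrema cardsU minima_maxima_disjoint cards0 subn0. Qed.

Lemma sum_splittings x y d : (0 < x)%N -> (0 < y)%N ->
  ((x + y == d) : nat) = (\sum_(1 <= a < d) ((x == a) && (y == d - a)%N))%N.
Proof.
move=> x0 y0; have [xd|dx] := ltnP x d; last first.
  rewrite big_nat_cond big1 => [|a /andP[]]; last by case: eqP => //=; lia.
  by rewrite (_ : (_ == _) = false) //; lia.
rewrite (bigD1_seq x) ?mem_index_iota ?iota_uniq /=; try lia.
rewrite eqxx big1 => [|a /negPf]; last by rewrite eq_sym => ->.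
by rewrite addn0; congr nat_of_bool; lia.
Qed.

(** There is always a minimum and a maximum, so a runs over 0 < a < d only; and
    since every cell has a neighbour, no cell is both. *)
Lemma count_extremaE m n d :
  count_extrema d m.+1 n.+2 =
    (\sum_(1 <= a < d) #|heights_with m.+1 n.+2 a (d - a)|)%N.
Proof.
rewrite /count_extrema -sum1dep_card big_mkcond /=.
transitivity (\sum_(h : height m.+1 n.+2)
   \sum_(1 <= a < d) (h \in heights_with m.+1 n.+2 a (d - a)%N))%N.
  apply: eq_bigr => h _; rewrite card_extrema.
  have [u minu] := exists_minimum h (ord0, ord0).
  have [v maxv] := exists_maximum h (ord0, ord0).
  rewrite (eq_bigr (fun a => ((#|minima h| == a) && (#|maxima h| == d - a)%N : nat))).
    rewrite -sum_splittings; first by case: (_ == _).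
      by apply/card_gt0P; exists u.
    by apply/card_gt0P; exists v.
  by move=> a _; rewrite inE.
rewrite exchange_big /=; apply: eq_bigr => a _.
by rewrite -sum1_card [RHS]big_mkcond.
Qed.

(** The symmetry under negation lets every term be taken with at least as many
    maxima as minima, the case in which the remainder is controlled. *)
Lemma count_extrema_sorted m n d :
  count_extrema d m.+1 n.+2 =
    (\sum_(1 <= a < d) #|heights_with m.+1 n.+2 (minn a (d - a)) (maxn a (d - a))|)%N.
Proof.
rewrite count_extremaE; apply: eq_big_nat => a _.
by case: (leqP a (d - a)) => _ //; rewrite card_heights_withC.
Qed.

(** Both the grid and the two paths are sorted in the same way, so the path
    terms add up again to full counts of paths. *)
Lemma count_extrema_sides m n d : (3 <= d)%N ->
  count_extrema d m.+2 n.+2 =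
    (\sum_(1 <= a < d) remainder (minn a (d - a)) (maxn a (d - a)) m.+2 n.+2
      + (count_extrema d 1 m.+2).*2 + (count_extrema d 1 n.+2).*2)%N.
Proof.
move=> d3; rewrite !count_extrema_sorted -!muln2 !big_distrl /= -!big_split /=.
apply: eq_big_nat => a ad.
rewrite card_heights_with_sides -?muln2; first exact: addnAC.
  by lia.
by lia.
Qed.

(** * Paths *)

Definition at_pos n (f : height 1 n.+2) (k : nat) : int := f (ord0, inord k).

Lemma at_posE n (f : height 1 n.+2) (j : 'I_n.+2) : f (ord0, j) = at_pos f j.
Proof. by rewrite /at_pos inord_val. Qed.

Definition turns n (f : height 1 n.+2) : {set 'I_n} :=
  [set k : 'I_n | at_pos f k == at_pos f k.+2].

Lemma at_pos_step n (f : height 1 n.+2) k : (k <= n)%N ->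
  at_pos f k.+1 = at_pos f k + 1 \/ at_pos f k.+1 = at_pos f k - 1.
Proof. by move=> kn; apply: height_adj; rewrite adj_row //= !inordK ?eqxx //; lia. Qed.

Lemma adj_line n (j k : 'I_n.+2) :
  adj (ord0 : 'I_1, j) (ord0, k) = (j.+1 == k :> nat) || (k.+1 == j :> nat).
Proof. by rewrite adj_row. Qed.

Lemma extrema_line n (f : height 1 n.+2) (j : 'I_n.+2) :
  reflect ((forall k : 'I_n.+2, (j.+1 = k :> nat) \/ (k.+1 = j :> nat) ->
               at_pos f k = at_pos f j + 1) \/
           (forall k : 'I_n.+2, (j.+1 = k :> nat) \/ (k.+1 = j :> nat) ->
               at_pos f k = at_pos f j - 1))
          ((ord0, j) \in extrema f).
Proof.
rewrite in_setU -minima_opp.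
apply: (iffP orP) => -[H|H]; [left|right|left|right].
- move=> k jk; rewrite -!at_posE; apply: (minima_adj H).
  by rewrite adj_line; lia.
- move=> k jk; have := @minima_adj _ _ _ _ (ord0, k) H.
  by rewrite !opp_heightE !at_posE adj_line; lia.
- apply/minimaP => -[i k]; rewrite [i]ord1 adj_line !at_posE => jk.
  by apply: H; lia.
- apply/minimaP => -[i k]; rewrite [i]ord1 adj_line !opp_heightE !at_posE => jk.
  by rewrite H; lia.
Qed.

(** The two ends of a path are always extrema, and an inner cell is one exactly
    when its two neighbours have the same value. *)
Lemma card_extrema_line n (f : height 1 n.+2) : #|extrema f| = #|turns f|.+2.
Proof.
rewrite -!sum1_card big_mkcond /= (reindex (pair (ord0 : 'I_1))) /=; last first.
  by exists snd => // -[i j] _; rewrite (ord1 i).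
rewrite big_ord_recl big_ord_recr /=.
have -> : (ord0, ord0) \in extrema f.
  apply/extrema_line; have := @at_pos_step _ f 0 isT.
  by case=> E; [left|right] => k [] //= <-.
have -> : (ord0, lift ord0 ord_max) \in extrema f.
  apply/extrema_line; rewrite /= /bump /=; have := @at_pos_step _ f n (leqnn n).
  case=> E; [right|left] => k; have := ltn_ord k; move=> kn [] /= Ek; try lia.
    have -> : k = n :> nat by lia.
    by rewrite add1n E addrK.
  have -> : k = n :> nat by lia.
  by rewrite add1n E subrK.
rewrite addn1 add1n; congr (_.+2); rewrite [RHS]big_mkcond /=.
apply: eq_bigr => k _; congr (if _ then _ else _); rewrite [RHS]inE.
have kn := ltn_ord k.
have := at_pos_step f (ltnW kn); have := at_pos_step f kn.
have lt0 : (k < n.+2)%N by lia.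
have lt2 : (k.+2 < n.+2)%N by lia.
move=> s1 s2; apply/extrema_line/eqP => [|E]; rewrite /= /bump /= !add1n.
  case=> H; have := H (Ordinal lt0); have := H (Ordinal lt2) => /=; lia.
have [Ek|Ek] : at_pos f k = at_pos f k.+1 + 1 \/ at_pos f k = at_pos f k.+1 - 1 by lia.
  by left => i [] Ei; [rewrite -Ei -E | have -> : i = k :> nat by lia].
by right => i [] Ei; [rewrite -Ei -E | have -> : i = k :> nat by lia].
Qed.

(** First step and turning cells, which together determine a path. *)
Definition path_code n (f : height 1 n.+2) : bool * {set 'I_n} :=
  (at_pos f 1 == 1, turns f).

Lemma path_code_inj n : injective (@path_code n).
Proof.
move=> f g [fg1 fgt].
have f0 (h : height 1 n.+2) : at_pos h 0 = 0.
  by apply: height_origin; rewrite /= ?inordK.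
suff H k : (k <= n)%N -> at_pos f k = at_pos g k /\ at_pos f k.+1 = at_pos g k.+1.
  apply: height_eqP => -[i [[|j] ltj]]; rewrite [i]ord1 !at_posE /=.
    by rewrite !f0.
  by have [] := H j ltj.
elim: k => [_|k IHk kn].
  rewrite !f0; split=> //; have := at_pos_step f (leq0n n).
  by have := at_pos_step g (leq0n n); rewrite !f0; lia.
have [Ek Ek1] := IHk (ltnW kn); split=> //.
have := at_pos_step f kn; have := at_pos_step g kn.
have := at_pos_step f (ltnW kn); have := at_pos_step g (ltnW kn).
have := congr1 (fun A : {set 'I_n} => Ordinal kn \in A) fgt.
by rewrite /= !inE /=; lia.
Qed.

(** The direction of the step from k to k + 1 (true is up) of the path that
    starts with step b and turns between steps j and j + 1 when s j holds. *)
Fixpoint path_step (b : bool) (s : pred nat) (k : nat) : bool :=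
  if k is j.+1 then path_step b s j (+) s j else b.

Fixpoint path_value (b : bool) (s : pred nat) (k : nat) : int :=
  if k is j.+1 then path_value b s j + (if path_step b s j then 1 else - 1) else 0.

Fact path_height_proof n b s :
  is_height [ffun u : cell 1 n.+2 => path_value b s u.2].
Proof.
apply: is_heightP => [[i j] [i' j']|u u1 u2]; rewrite !ffunE ?u2 //=.
rewrite [i]ord1 [i']ord1 adj_line => /orP[]/eqP <- /=; case: ifP => _; lia.
Qed.
Definition path_height n b s : height 1 n.+2 :=
  Height (path_height_proof n b s).

Lemma path_heightK n b (S : {set 'I_n}) :
  path_code (path_height n b (fun k => k \in map val (enum S))) = (b, S).
Proof.
have E s k : (k < n.+2)%N -> at_pos (path_height n b s) k = path_value b s k.
  by move=> kn; rewrite /at_pos ffunE /= inordK.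
congr pair; first by rewrite E //=; case: (b).
apply/setP => k; have kn := ltn_ord k; rewrite inE !E /=; try lia.
rewrite (mem_map val_inj) mem_enum.
by case: (path_step _ _ _); case: (k \in S) => /=; lia.
Qed.

Lemma count_extrema_line n d :
  count_extrema d.+2 1 n.+2 = ('C(n, d)).*2.
Proof.
pose dec x := path_height n x.1 (fun k => k \in map val (enum (x.2 : {set 'I_n}))).
have decK : cancel dec (@path_code n) by case=> b S; exact: path_heightK.
have bij : bijective (@path_code n).
  by exists dec => // f; apply: path_code_inj; rewrite decK.
transitivity #|[set x : bool * {set 'I_n} | #|x.2| == d]|.
  rewrite -(on_card_preimset (onW_bij _ bij)).
  by apply: eq_card => f; rewrite !inE card_extrema_line !eqSS.
rewrite -[n in RHS]card_ord -card_draws.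
have -> : [set x : bool * {set 'I_n} | #|x.2| == d]
  = setX [set: bool] [set A : {set 'I_n} | #|A| == d].
  by apply/setP => -[b A]; rewrite !inE.
by rewrite cardsX cardsT card_bool mul2n.
Qed.

(** * Polynomials determined by their values at large integer points *)

(** A nonzero polynomial of size s has fewer than s roots. *)
Lemma poly_eventually0 (R : numDomainType) (N : nat) (q : {poly R}) :
  (forall k, (N <= k)%N -> q.[k%:R] = 0) -> q = 0.
Proof.
move=> q0; apply/eqP; apply: contraT => qn0.
pose s := [seq k%:R : R | k <- iota N (size q)].
have : (size s < size q)%N.
  apply: max_poly_roots => //.
    by apply/allP => _ /mapP[k + ->]; rewrite mem_iota => /andP[/q0 q0k _]; apply/eqP.
  by rewrite map_inj_uniq ?iota_uniq // => j k /eqP; rewrite eqr_nat => /eqP.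
by rewrite size_map size_iota ltnn.
Qed.

(** Evaluating in two stages: the last variable is set apart by muni. *)
Lemma meval_muni (R : numDomainType) n (v : 'I_n.+1 -> R) (p : {mpoly R[n.+1]}) :
  p.@[v] = (map_poly (meval (fun i => v (widen_ord (leqnSn n) i))) (muni p)).[v ord_max].
Proof.
rewrite muniE mevalE rmorph_sum /= horner_sum; apply: eq_bigr => m _.
rewrite -!mul_polyC !rmorphM /= map_polyC map_polyXn !hornerE big_ord_recr /= mulrA.
rewrite mevalZ mevalX; congr (_ * _ * _).
by apply: eq_bigr => i _; rewrite mnmE.
Qed.

Lemma muni_eq0 (R : numDomainType) n (p : {mpoly R[n.+1]}) : muni p = 0 -> p = 0.
Proof.
move=> p0; apply/mpolyP => m; rewrite mcoeff0.
have := congr1 (fun q : {poly {mpoly R[n]}} =>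
   q`_(m ord_max)@_[multinom (m (widen_ord (leqnSn n) i)) | i < n]) p0.
rewrite coef0 mcoeff0 muniE coef_sum raddf_sum /= => <-.
rewrite {1}[p]mpolyE raddf_sum /=; apply: eq_bigr => k _.
rewrite mcoeffZ mcoeffX coefZ coefXn mulr_natr -scaler_nat.
rewrite !mcoeffZ mcoeffX mulrCA -natrM mulnb; congr (_ * _%:R); congr nat_of_bool.
rewrite eq_sym; apply/eqP/andP => [->|[/eqP Emax /eqP Ewid]]; first by rewrite !eqxx.
apply/mnmP => i; case: (unliftP ord_max i) => [j|] ->; last by [].
have -> : lift ord_max j = widen_ord (leqnSn n) j.
  by apply: val_inj; rewrite /= /bump leqNgt ltn_ord.
by have := congr1 (fun x : 'X_{1..n} => x j) Ewid; rewrite !mnmE.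
Qed.
(** Induction on the number of variables: once the first n variables are fixed
    at large integers, the polynomial in the last one has infinitely many roots,
    so each of its coefficients, a polynomial in n variables, vanishes at all
    large integer points. *)
Lemma mpoly_eventually0 (R : numDomainType) n (N : nat) (p : {mpoly R[n]}) :
    (forall v : 'I_n -> nat, (forall i, (N <= v i)%N) ->
       p.@[fun i => (v i)%:R] = 0) ->
  p = 0.
Proof.
elim: n p => [|n IHn] p p0.
  have := p0 (fun=> N) (fun=> leqnn N).
  rewrite [p]msize1_polyC ?mevalC => [->|]; first by rewrite mpolyC0.
  rewrite msizeE; apply/bigmax_leqP_seq => m _ _.
  by rewrite mdegE big_ord0.
apply: muni_eq0; apply/polyP => k; rewrite coef0; apply: IHn => v' v'N.
rewrite -coef_map [map_poly _ _](@poly_eventually0 _ N) ?coef0 // => j jN.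
pose v (i : 'I_n.+1) := if unlift ord_max i is Some i' then v' i' else j.
have := p0 v; rewrite meval_muni /v unlift_none => <-.
  congr (_.[_]); apply: eq_map_poly => c; apply: meval_eq => i.
  have -> : widen_ord (leqnSn n) i = lift ord_max i.
    by apply: val_inj; rewrite /= /bump leqNgt ltn_ord.
  by rewrite liftK.
by move=> i; case: unlift.
Qed.

(** * Leading parts *)

Lemma pihomog_small n (R : nzRingType) (q : {mpoly R[n]}) k :
  (msize q <= k)%N -> pihomog mdeg k q = 0.
Proof.
move=> qk; rewrite pihomogE big_seq_cond big1 // => m /andP[/msize_mdeg_lt mq /eqP mk].
by move: mq; rewrite mk ltnNge qk.
Qed.

Definition subst_var n (R : comNzRingType) (P : {poly R}) (i : 'I_n) : {mpoly R[n]} :=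
  \sum_(j < size P) P`_j *: 'X_i ^+ j.

Lemma meval_subst_var n (R : comNzRingType) (P : {poly R}) (i : 'I_n) v :
  (subst_var P i).@[v] = P.[v i].
Proof.
rewrite raddf_sum horner_coef /=; apply: eq_bigr => j _.
by rewrite mevalZ rmorphXn /= mevalXU.
Qed.

Lemma pihomog_subst_var n (R : comNzRingType) (P : {poly R}) (i : 'I_n) k :
  P \is monic -> size P = k.+1 -> pihomog mdeg k (subst_var P i) = 'X_i ^+ k.
Proof.
move=> /monicP; rewrite lead_coefE => Pm sP.
have piX j : pihomog mdeg k ('X_i ^+ j : {mpoly R[n]}) =
    if j == k then 'X_i ^+ j else 0.
  have degXj : mdeg (U_(i) *+ j)%MM = j by rewrite mdegMn mdeg1 mul1n.
  by rewrite mpolyXn pihomogX; congr (if _ == k then _ else _); exact: degXj.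
rewrite /subst_var raddf_sum /= sP big_ord_recr /= big1 => [|j _].
  by rewrite add0r linearZ /= piX eqxx; move: Pm; rewrite sP /= => ->; rewrite scale1r.
by rewrite linearZ /= piX ltn_eqF // scaler0.
Qed.

(** The polynomial C(x - 2, k) * k!, where x - 2 is the number of inner cells of
    a path with x cells. *)
Definition ffact_poly (k : nat) : {poly rat} :=
  \prod_(j < k) ('X - (j.+2%:R)%:P).

Lemma ffact_poly_monic k : ffact_poly k \is monic.
Proof. exact: monic_prod_XsubC. Qed.

Lemma size_ffact_poly k : size (ffact_poly k) = k.+1.
Proof. by rewrite size_prod_XsubC [index_enum _]unlock -enumT size_enum_ord. Qed.

Lemma ffact_polyE k n : (k <= n)%N -> (ffact_poly k).[n.+2%:R] = (n ^_ k)%:R.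
Proof.
move=> kn; rewrite horner_prod ffact_prod natr_prod; apply: eq_bigr => j _.
rewrite hornerXsubC natrB; last by apply: ltnW; apply: leq_trans kn.
by rewrite -[n.+2]addn2 -[(j : nat).+2]addn2 !natrD opprD addrACA subrr addr0.
Qed.

Theorem proposition8p4 (bound : degree_bound)
    (d : nat) (hd : (5 <= d)%N)
    (p : {mpoly rat[2]})
    (hp : agrees_from (maxn d.-1 2) p (count_extrema d)) :
  pihomog mdeg (d - 2) p =
    (4 / ((d - 2)`!)%:R) *: ('X_ord0 ^+ (d - 2) + 'X_ord_max ^+ (d - 2)).
Proof.
case: d hd hp => [|[|k]] // k3 hp; rewrite !subSS subn0.
pose lo (a : nat) := minn a.+1 (k.+2 - a.+1).
pose hi (a : nat) := maxn a.+1 (k.+2 - a.+1).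
have q_ex (a : 'I_k.+1) : exists q : {mpoly rat[2]},
    agrees_from (2 * k.+2 - 1) q (remainder (lo a) (hi a)) /\
    total_degree_le (k.+2 - 3) q.
  by have := ltn_ord a; rewrite /lo /hi => ak; apply: bound; lia.
have [q qP] := fin_all_exists q_ex.
(* F i is C(x - 2, k) * k! as a polynomial in the variable of index i; only its
   values and its leading part matter below. *)
have [F evalF topF] : exists2 F : 'I_2 -> {mpoly rat[2]},
    (forall i v, (F i).@[v] = (ffact_poly k).[v i]) &
    (forall i, pihomog mdeg k (F i) = 'X_i ^+ k).
  exists (subst_var (ffact_poly k)) => [i v|i]; first exact: meval_subst_var.
  exact: pihomog_subst_var (ffact_poly_monic k) (size_ffact_poly k).
pose Q : {mpoly rat[2]} :=
  \sum_(a < k.+1) q a + (4 / k`!%:R) *: (F ord0 + F ord_max).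
have -> : p = Q.
  apply/eqP; rewrite -subr_eq0; apply/eqP.
  apply: (@mpoly_eventually0 _ _ (2 * k.+2)) => v vN.
  rewrite (meval_eq (v2 := point (v ord0) (v ord_max))); last first.
    move=> i; rewrite /point; case: eqP => [->//|i_neq0]; congr (v _)%:R.
    case: i i_neq0 => [[|[|//]] lti] i_neq0; last exact: val_inj.
    by case: i_neq0; exact: val_inj.
  have := vN ord0; have := vN ord_max.
  move: (v ord0) (v ord_max) => [|[|m]] [|[|n]] // nN mN.
  rewrite mevalB hp; try lia.
  rewrite count_extrema_sides; last by lia.
  rewrite big_add1 big_mkord /= !count_extrema_line.
  rewrite 2!natrD natr_sum mevalD raddf_sum mevalZ mevalD /=.
  rewrite (eq_bigr (fun a => (q a).@[point m.+2 n.+2])); last first.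
    by move=> a _; have [-> //] := qP a; lia.
  rewrite !evalF !ffact_polyE -?bin_ffact /=; try lia.
  have kfact : k`!%:R != 0 :> rat by rewrite pnatr_eq0 -lt0n fact_gt0.
  by rewrite !natrM -!muln2 !natrM; field.
have kdeg : (k.+2 - 3).+1 = k by lia.
rewrite /Q linearD linear_sum linearZ linearD /= !topF big1 ?add0r // => a _.
apply: pihomog_small.
by have [_] := qP a; rewrite /total_degree_le kdeg.
Qed.
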